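(* Let $R$ be a (not necessarily unital) associative ring that is locally nilpotent and satisfies a polynomial identity, and let $\delta$ be a derivation of $R$. Then the differential polynomial ring $R[x;\delta]$ is locally nilpotent.
   Context: Rings are associative and not necessarily unital. A derivation of $R$ is an additive map $\delta:R\to R$ with $\delta(ab)=\delta(a)b+a\delta(b)$ for all $a,b\in R$. The differential polynomial ring $R[x;\delta]$ is, as a set (and additive group), the set of all polynomials $a_nx^n+\cdots+a_1x+a_0$ with $n\ge 0$ and $a_0,\ldots,a_n\in R$; multiplication is determined by $xa=ax+\delta(a)$ for $a\in R$, extended by associativity and linearity. Explicitly, $(ax^p)(bx^q)=\sum_{j=0}^{p}\binom{p}{j}\,a\,\delta^j(b)\,x^{p+q-j}$ for $a,b\in R$, $p,q\ge 0$. When $R$ is not unital, $x$ itself need not be an element of $R[x;\delta]$. A ring $S$ is nilpotent if there is $n\ge 1$ such that every product of $n$ elements of $S$ is zero. A ring is locally nilpotent if every finitely generated (not necessarily unital) subring of it is nilpotent. A ring $R$ satisfies a polynomial identity (is a PI ring) if there is a polynomial $f(X_1,\ldots,X_m)$ in noncommuting variables with integer coefficients and zero constant term, which is monic in the sense that at least one of its monomials of highest total degree has coefficient $1$, such that $f(r_1,\ldots,r_m)=0$ for all $r_1,\ldots,r_m\in R$. *)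

(* Defs.v *)
From HB Require Import structures.
From mathcomp Require Import all_boot all_order all_algebra.
From mathcomp Require Import finmap.
From mathcomp.multinomials Require Import monalg.

Set Implicit Arguments.
Unset Strict Implicit.
Unset Printing Implicit Defensive.

Import GRing.Theory.
Local Open Scope ring_scope.

Declare Scope rng_scope.
Delimit Scope rng_scope with rng.
Local Open Scope rng_scope.

(* MathComp's ring structures all have a unit, so associative rings without
   one get a structure of their own. *)
HB.mixin Record Zmodule_isRng R of GRing.Zmodule R := {
  rmul : R -> R -> R;
  rmulA : associative rmul;
  rmulDl : left_distributive rmul +%R;
  rmulDr : right_distributive rmul +%R
}.

#[short(type="rngType")]
HB.structure Definition Rng := {R of Zmodule_isRng R & GRing.Zmodule R}.

Notation "x ** y" := (rmul x y) (at level 40, left associativity) : rng_scope.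

Section RngTheory.
Variable R : rngType.
Implicit Types x y z : R.

Lemma rmul_zmod_morphism x : zmod_morphism (rmul x).
Proof.
by move=> y z; apply: (addIr (x ** z)); rewrite -rmulDr !subrK.
Qed.

HB.instance Definition _ x :=
  GRing.isZmodMorphism.Build R R (rmul x) (rmul_zmod_morphism x).

Definition rmulr y x := rmul x y.

Lemma rmulr_zmod_morphism y : zmod_morphism (rmulr y).
Proof.
by move=> x z; apply: (addIr (z ** y)); rewrite -rmulDl !subrK.
Qed.

HB.instance Definition _ y :=
  GRing.isZmodMorphism.Build R R (rmulr y) (rmulr_zmod_morphism y).

Lemma rmul0 x : x ** 0 = 0. Proof. exact: raddf0. Qed.
Lemma r0mul x : 0 ** x = 0. Proof. exact: (raddf0 (rmulr x)). Qed.
Lemma rmulBl x y z : (x - y) ** z = x ** z - y ** z.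
Proof. exact: (raddfB (rmulr z)). Qed.
Lemma rmulMnr x y n : x ** (y *+ n) = (x ** y) *+ n. Proof. exact: raddfMn. Qed.
Lemma rmulMnl x y n : (x *+ n) ** y = (x ** y) *+ n.
Proof. exact: (raddfMn (rmulr y)). Qed.

End RngTheory.

(* Without a unit the empty product is meaningless: [rprod [::] = 0] is a
   dummy value, and every use below concerns nonempty sequences. *)
Definition rprod (R : rngType) (s : seq R) : R :=
  if s is x :: s' then foldl (@rmul R) x s' else 0.

Definition subrng_closed (R : rngType) (S : R -> Prop) : Prop :=
  [/\ S 0, forall x y, S x -> S y -> S (x - y)
         & forall x y, S x -> S y -> S (x ** y)].

Definition subrng_gen (R : rngType) (X : seq R) (x : R) : Prop :=
  forall S : R -> Prop, subrng_closed S -> (forall y, y \in X -> S y) -> S x.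

Definition nilpotent_subrng (R : rngType) (S : R -> Prop) : Prop :=
  exists2 n, (0 < n)%N &
    forall s : n.-tuple R, (forall x, x \in s -> S x) -> rprod s = 0.

Definition locally_nilpotent (R : rngType) : Prop :=
  forall X : seq R, nilpotent_subrng (subrng_gen X).

(* Elements of the free ring Z<X_1, ..., X_m> are finitely supported
   functions from words in 'I_m to int; [mone] is the empty word. *)
Definition ncpoly (m : nat) := {malg int[{fmonom 'I_m}]}.

Definition nceval (R : rngType) (m : nat) (r : 'I_m -> R) (f : ncpoly m) : R :=
  \sum_(w <- msupp f) rprod [seq r i | i <- w] *~ f@_w.

Definition ncmonic (m : nat) (f : ncpoly m) : Prop :=
  exists2 w, f@_w = 1 & forall w', w' \in msupp f -> (fdeg w' <= fdeg w)%N.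

Definition PI_rng (R : rngType) : Prop :=
  exists m (f : ncpoly m),
    [/\ f@_mone = 0, ncmonic f & forall r : 'I_m -> R, nceval r f = 0].

HB.mixin Record isDerivation (R : rngType) (delta : R -> R) := {
  derivationM : forall a b, delta (a ** b) = delta a ** b + a ** delta b
}.

#[short(type="derivation")]
HB.structure Definition Derivation (R : rngType) :=
  {delta of isDerivation R delta & @GRing.Additive R R delta}.

(* [<< a *g p >>] is the monomial a x^p, and [f@_p] the coefficient of x^p. *)
Definition diffpoly (R : rngType) (delta : derivation R) := {malg R[nat]}.

HB.instance Definition _ (R : rngType) (delta : derivation R) :=
  GRing.Zmodule.on (diffpoly delta).

Definition dpmul (R : rngType) (delta : derivation R) (f g : diffpoly delta) :
    diffpoly delta :=
  \sum_(p <- msupp f) \sum_(q <- msupp g) \sum_(j < p.+1)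
    << (f@_p ** iter j delta g@_q) *+ 'C(p, j) *g (p + q - j)%N >>.

(* Sums over the support of an additive function of the coefficients. *)
Section Extend.
Variables (G V : zmodType) (F : nat -> {additive G -> V}).

Definition mext (f : {malg G[nat]}) : V := \sum_(p <- msupp f) F p f@_p.

Lemma mextEw (d : {fset nat}) f : (msupp f `<=` d)%fset ->
  mext f = \sum_(p <- d) F p f@_p.
Proof.
move=> le; rewrite /mext (big_fset_incl _ le) // => p _ pf.
by rewrite mcoeff_outdom // raddf0.
Qed.

Lemma mextU a p : mext << a *g p >> = F p a.
Proof. by rewrite (mextEw msuppU_le) big_seq_fset1 mcoeffUU. Qed.

Lemma mext_zmod_morphism : zmod_morphism mext.
Proof.
move=> f g; rewrite (mextEw (msuppB_le f g)).
rewrite (mextEw (fsubsetUl _ (msupp g))) (mextEw (fsubsetUr (msupp f) _)).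
by rewrite -sumrB; apply: eq_bigr => p _; rewrite mcoeffB raddfB.
Qed.

HB.instance Definition _ :=
  GRing.isZmodMorphism.Build {malg G[nat]} V mext mext_zmod_morphism.

End Extend.

Lemma malg_additive_eq (G V : zmodType) (H1 H2 : {additive {malg G[nat]} -> V}) :
  (forall a p, H1 << a *g p >> = H2 << a *g p >>) -> H1 =1 H2.
Proof.
by move=> H12 f; rewrite [f]monalgE !raddf_sum; apply: eq_bigr.
Qed.

Section DiffPolyTheory.
Variables (R : rngType) (delta : derivation R).
Local Notation P := (diffpoly delta).
Implicit Types (a b c : R) (f g h : P) (p q r : nat).

Definition dpmono p b : P := << b *g p >>.

Lemma dpmono_zmod_morphism p : zmod_morphism (dpmono p).
Proof. by move=> b c; rewrite /dpmono monalgUB. Qed.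

HB.instance Definition _ p :=
  GRing.isZmodMorphism.Build R P (dpmono p) (dpmono_zmod_morphism p).

(* Left multiplication by [a x^p] is the composite of [dpscale a], which
   multiplies all coefficients by a on the left, and the p-th power of
   [dpX], which sends b x^q to b x^{q+1} + delta(b) x^q. *)
Definition dpscale a : P -> P := mext (fun q => dpmono q \o rmul a).
Definition dpX : P -> P :=
  mext (fun q => dpmono q.+1 \+ (dpmono q \o delta)).

HB.instance Definition _ a := GRing.Additive.copy (dpscale a)
  (mext (fun q => dpmono q \o rmul a)).
HB.instance Definition _ := GRing.Additive.copy dpX
  (mext (fun q => dpmono q.+1 \+ (dpmono q \o delta))).

Lemma dpscaleU a b q : dpscale a << b *g q >> = << a ** b *g q >>.
Proof. exact: mextU. Qed.

Lemma dpXU b q : dpX << b *g q >> = << b *g q.+1 >> + << delta b *g q >>.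
Proof. exact: mextU. Qed.

Lemma iter_dpX_zmod_morphism p : zmod_morphism (iter p dpX).
Proof. by elim: p => // p IH f g; rewrite !iterS IH raddfB. Qed.

HB.instance Definition _ p :=
  GRing.isZmodMorphism.Build P P (iter p dpX) (iter_dpX_zmod_morphism p).

Lemma iter_dpXU p b q :
  iter p dpX << b *g q >> =
    \sum_(j < p.+1) << iter j delta b *+ 'C(p, j) *g (p + q - j)%N >>.
Proof.
elim: p => [|p IH]; first by rewrite big_ord1 bin0 /= subn0.
rewrite iterS IH raddf_sum [RHS]big_ord_recl bin0 /= mulr1n subn0 addSn.
under eq_bigr do rewrite dpXU raddfMn /=.
rewrite big_split /= big_ord_recl bin0 mulr1n subn0 -addrA; congr (_ + _).
under [RHS]eq_bigr => i _.
  rewrite /bump /= add1n binS mulrnDr monalgUD subSS; over.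
rewrite big_split /=; congr (_ + _); last first.
  by apply: eq_bigr => i _; rewrite raddfMn.
rewrite [RHS]big_ord_recr /= [X in _ *+ X]bin_small // mulr0n monalgU0 addr0.
apply: eq_bigr => i _; rewrite /bump /= add1n -subSn ?raddfMn ?subSS //.
exact: leq_trans (ltn_ord i) (leq_addr q p).
Qed.

Lemma dpscaleBl a b f : dpscale (a - b) f = dpscale a f - dpscale b f.
Proof.
pose H := dpscale a \- dpscale b.
rewrite -[RHS]/(H f); apply: malg_additive_eq => c q.
by rewrite /= !dpscaleU rmulBl monalgUB.
Qed.

Definition dpscale_at f a := dpscale a f.

Lemma dpscale_at_zmod_morphism f : zmod_morphism (dpscale_at f).
Proof. by move=> a b; rewrite /dpscale_at dpscaleBl. Qed.

HB.instance Definition _ f :=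
  GRing.isZmodMorphism.Build R P (dpscale_at f) (dpscale_at_zmod_morphism f).

Lemma dpmulE f g : dpmul f g = mext (fun p => dpscale_at (iter p dpX g)) f.
Proof.
apply: eq_bigr => p _; rewrite -[RHS]/(dpscale _ _) [g in RHS]monalgE !raddf_sum.
apply: eq_bigr => q _; rewrite /= iter_dpXU raddf_sum.
by apply: eq_bigr => j _; rewrite /= dpscaleU rmulMnr.
Qed.

Lemma dpmulUl a p g : dpmul << a *g p >> g = dpscale a (iter p dpX g).
Proof. by rewrite dpmulE mextU. Qed.

Lemma dpmulUU a b p q :
  dpmul << a *g p >> << b *g q >> = \sum_(j < p.+1)
    << (a ** iter j delta b) *+ 'C(p, j) *g (p + q - j)%N >> :> P.
Proof.
rewrite dpmulUl iter_dpXU raddf_sum.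
by apply: eq_bigr => j _; rewrite /= dpscaleU rmulMnr.
Qed.

Lemma dpmulDl : left_distributive (@dpmul R delta) +%R.
Proof. by move=> f g h; rewrite !dpmulE raddfD. Qed.

Lemma dpmulDr : right_distributive (@dpmul R delta) +%R.
Proof.
move=> f g h; rewrite !dpmulE -big_split; apply: eq_bigr => p _.
by rewrite /= /dpscale_at !raddfD.
Qed.

Definition dpmulr g f := dpmul f g.

Lemma dpmulr_zmod_morphism g : zmod_morphism (dpmulr g).
Proof. by move=> f h; rewrite /dpmulr !dpmulE raddfB. Qed.

HB.instance Definition _ g :=
  GRing.isZmodMorphism.Build P P (dpmulr g) (dpmulr_zmod_morphism g).

Lemma dpscaleA a b f : dpscale a (dpscale b f) = dpscale (a ** b) f.
Proof.
pose H := dpscale a \o dpscale b.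
rewrite -[LHS]/(H f); apply: malg_additive_eq => c q.
by rewrite /= !dpscaleU rmulA.
Qed.

Lemma dpX_scale a f :
  dpX (dpscale a f) = dpscale a (dpX f) + dpscale (delta a) f.
Proof.
pose H1 := dpX \o dpscale a; pose H2 := (dpscale a \o dpX) \+ dpscale (delta a).
rewrite -[LHS]/(H1 f) -[RHS]/(H2 f); apply: malg_additive_eq => c q.
rewrite /= dpscaleU !dpXU raddfD /= !dpscaleU derivationM monalgUD.
by rewrite -addrA; congr (_ + _); rewrite addrC.
Qed.

Lemma dpscale_mul a g h : dpmul (dpscale a g) h = dpscale a (dpmul g h).
Proof.
pose H1 := dpmulr h \o dpscale a; pose H2 := dpscale a \o dpmulr h.
rewrite -[LHS]/(H1 g) -[RHS]/(H2 g); apply: malg_additive_eq => c q.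
by rewrite /= /dpmulr dpscaleU !dpmulUl dpscaleA.
Qed.

Lemma dpX_mul g h : dpmul (dpX g) h = dpX (dpmul g h).
Proof.
pose H1 := dpmulr h \o dpX; pose H2 := dpX \o dpmulr h.
rewrite -[LHS]/(H1 g) -[RHS]/(H2 g); apply: malg_additive_eq => c q.
by rewrite /= /dpmulr dpXU dpmulDl !dpmulUl dpX_scale.
Qed.

Lemma dpmulA : associative (@dpmul R delta).
Proof.
move=> f g h.
rewrite [LHS]dpmulE [dpmul f g]dpmulE -[RHS]/(dpmulr h _) raddf_sum.
apply: eq_bigr => p _; rewrite /dpscale_at /= /dpmulr dpscale_mul.
by congr (dpscale _ _); elim: (p) => // n IH; rewrite !iterS dpX_mul IH.
Qed.

HB.instance Definition _ :=
  Zmodule_isRng.Build P dpmulA dpmulDl dpmulDr.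

Lemma diffpoly_mulUU a b p q :
  (<< a *g p >> : P) ** << b *g q >> = \sum_(j < p.+1)
    << (a ** iter j delta b) *+ 'C(p, j) *g (p + q - j)%N >>.
Proof. exact: dpmulUU. Qed.

End DiffPolyTheory.

(* Main.v *)
From HB Require Import structures.
From mathcomp Require Import all_boot all_fingroup all_algebra.
From mathcomp Require Import zify.
From mathcomp Require Import finmap.
From mathcomp.multinomials Require Import monalg.
Require Import Defs.

(** Finitely many elements of R[x; delta] involve a finite set A of coefficients
    and a bounded degree d. Multiplying n of them and moving all powers of x to
    the right produces monomials c x^q in which c is a combination of words
    delta^j1(a_1) ... delta^jn(a_n) with a_i in A. Each factor contributes at
    most d powers of x, and such a power either survives or is spent on one
    application of delta, so j_1 + ... + j_n + q <= d n ([filteredM]). Hence it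
    suffices that long words of total weight j_1 + ... + j_n at most d times
    their length vanish in R ([sparse_words_vanish]).

    Let the letter delta^j(a) have weight j. For each D the letters of weight at
    most D are finitely many, so a block of length m(D) made of them is zero by
    local nilpotence: in a nonzero word every such block contains a letter
    heavier than D. On the other hand letters heavier than a large D' are rare
    because the average weight is at most d, so some block of length m(D) has
    all weights at most D', and thus a letter of weight in (D, D']. Repeating
    this with larger and larger bounds, from right to left, gives in every long
    nonzero word k letters of strictly decreasing weight
    ([descending_letters]).

    A polynomial identity of degree k yields a multilinear one
    ([PI_multilinear]), which writes y_1 ... y_k as a combination of the products
    of the y_i in the other orders. Cut a nonzero word before its k letters of
    decreasing weight and apply the identity to the k pieces: every other order
    gives a word with the same letters whose sequence of weights is
    lexicographically smaller. Length and total weight being unchanged, induction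
    on the lexicographic order shows that the word is zero. *)

Set Implicit Arguments.
Unset Strict Implicit.
Unset Printing Implicit Defensive.

Import GRing.Theory.
Local Open Scope ring_scope.
Local Open Scope rng_scope.

(** * Adjoining a unit *)

(** The Dorroh extension: pairs (n, a) stand for n + a. Inside it products of
    words are iterated products of a ring, with the empty word equal to 1. *)
Definition unitization (R : rngType) : Type := (int * R)%type.

HB.instance Definition _ (R : rngType) :=
  GRing.Zmodule.copy (unitization R) (int * R)%type.

Section Unitization.
Variable R : rngType.
Implicit Types x y z : unitization R.

Definition umul x y : unitization R :=
  (x.1 * y.1, y.2 *~ x.1 + x.2 *~ y.1 + x.2 ** y.2).

Lemma rmulMzr (a b : R) (n : int) : a ** (b *~ n) = (a ** b) *~ n.
Proof. exact: raddfMz. Qed.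

Lemma rmulMzl (a b : R) (n : int) : (a *~ n) ** b = (a ** b) *~ n.
Proof. exact: (raddfMz (rmulr b)). Qed.

Lemma umulA : associative umul.
Proof.
move=> x y z; rewrite /umul /= mulrA; congr (_, _).
rewrite !rmulDl !rmulDr !mulrzDl !rmulMzr !rmulMzl rmulA -!mulrzA.
rewrite [y.1 * x.1]mulrC [z.1 * x.1]mulrC.
by rewrite [LHS](AC (4*3) (1*(2*4*6)*(3*5*7)))%AC.
Qed.

Lemma umul1r : left_id ((1, 0) : unitization R) umul.
Proof. by case=> n a; rewrite /umul /= mul1r r0mul mul0rz !addr0. Qed.

Lemma umulr1 : right_id ((1, 0) : unitization R) umul.
Proof. by case=> n a; rewrite /umul /= mulr1 rmul0 mul0rz add0r addr0. Qed.

Lemma umulDl : left_distributive umul +%R.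
Proof.
move=> x y z; rewrite /umul; congr (_, _) => /=; first exact: mulrDl.
by rewrite mulrzDl mulrzDr rmulDl [LHS](AC (2*2*2) (1*3*5*(2*4*6)))%AC.
Qed.

Lemma umulDr : right_distributive umul +%R.
Proof.
move=> x y z; rewrite /umul; congr (_, _) => /=; first exact: mulrDr.
by rewrite mulrzDl mulrzDr rmulDr [LHS](AC (2*2*2) (1*3*5*(2*4*6)))%AC.
Qed.

HB.instance Definition _ := GRing.Zmodule_isPzRing.Build (unitization R)
  umulA umul1r umulr1 umulDl umulDr.

Definition uinj (a : R) : unitization R := (0, a).

Lemma uinj_zmod_morphism : zmod_morphism uinj.
Proof. by move=> a b; rewrite /uinj; congr (_, _). Qed.

HB.instance Definition _ :=
  GRing.isZmodMorphism.Build R (unitization R) uinj uinj_zmod_morphism.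

Lemma uinj_inj : injective uinj.
Proof. by move=> a b []. Qed.

Lemma uinjM a b : uinj (a ** b) = uinj a * uinj b.
Proof. by rewrite /uinj; congr (_, _); rewrite /= !mulr0z !add0r. Qed.

Lemma uinj_rprod (s : seq R) : s != [::] ->
  uinj (rprod s) = \prod_(a <- s) uinj a.
Proof.
case: s => //= a s _; elim: s a => [|b s IH] a /=; first by rewrite big_seq1.
by rewrite IH !big_cons uinjM mulrA.
Qed.

End Unitization.

(** * Multilinear identities *)

Section Polarization.
Variable k : nat.

(** The factors outside [T] carry the sign, so this is (-1)^(k - #|T|), the sign
    of the term T in the polarization formula. *)
Definition set_sign (T : {set 'I_k}) : int :=
  \prod_(t < k) (if t \in T then 1 else -1).

(** Expanding the product over t of 1 - [t is not in A] gives the left-hand side,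
    and that product is 1 when A is everything and 0 otherwise. *)
Lemma sum_set_sign (A : {set 'I_k}) :
  \sum_(T : {set 'I_k} | A \subset T) set_sign T = (A == setT)%:R.
Proof.
transitivity (\prod_(t < k) (1 + - (t \notin A)%:R) : int).
  rewrite bigA_distr big_mkcond; apply: eq_bigr => T _.
  case: ifPn => [/subsetP AT | /subsetPn[t tA tT]].
    apply: eq_bigr => t _; case: ifPn => // tT.
    by rewrite (contra (AT t)).
  by rewrite (bigD1 t) //= (negPf tT) tA /= oppr0 mul0r.
have [->|] := eqVneq A setT.
  by apply: big1 => t _; rewrite inE subr0.
rewrite -subTset => /subsetPn[t _ tA].
by rewrite (bigD1 t) //= tA subrr mul0r.
Qed.

Variables (S : pzRingType) (I : eqType) (w : 'I_k -> I) (z : 'I_k -> S).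

(** Polarization of one monomial l of degree at most k: the variable i is
    replaced by the sum of the z t with t in T and w t = i. A choice g of one
    summand for each factor of l contributes to the sets T that contain its
    image, and by [sum_set_sign] only the surjective choices survive, that is,
    the permutations if l has degree k and none if l is shorter. *)
Lemma polarize_monomial n (l : n.-tuple I) : (n <= k)%N ->
  \sum_(T : {set 'I_k})
     (\prod_(i <- l) \sum_(t | (t \in T) && (w t == i)) z t) *~ set_sign T =
  \sum_(s : 'S_k | [seq w (s i) | i <- enum 'I_k] == l) \prod_i z (s i).
Proof.
move=> le_nk.
pose ok (g : {ffun 'I_n -> 'I_k}) := [forall j, w (g j) == tnth l j].
pose im (g : {ffun 'I_n -> 'I_k}) := g @: [set: 'I_n].
transitivity (\sum_(g | ok g && (im g == setT)) \prod_j z (g j)).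
  under eq_bigr => T _.
    rewrite big_tuple bigA_distr_big_dep.
    rewrite (eq_bigl (fun g => ok g && (im g \subset T))); last first.
      move=> g; apply/familyP/andP => [gT|[/forallP okg /subsetP sgT] j].
        split; first by apply/forallP => j; case/andP: (gT j).
        by apply/subsetP => _ /imsetP[j _ ->]; case/andP: (gT j).
      by rewrite unfold_in /= okg sgT ?imset_f.
    rewrite -mulrzl big_distrr /= big_mkcond; over.
  rewrite exchange_big /= [RHS]big_mkcond; apply: eq_bigr => g _.
  rewrite -big_mkcond /=; case: (ok g); last by rewrite big_pred0.
  rewrite -big_distrl /= -(raddf_sum (intr : {additive int -> S})) sum_set_sign.
  by case: (_ == _); rewrite ?mul1r ?mul0r.
have [nk|nk] := ltnP n k.
  rewrite !big_pred0 // => [s|g].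
    apply/negP => /eqP /(congr1 size).
    rewrite size_map size_enum_ord size_tuple.
    by move=> kn; rewrite kn ltnn in nk.
  apply/negP => /andP[_ /eqP /(congr1 (fun A : {set _} => #|A|))].
  rewrite cardsT card_ord => imk; have := leq_imset_card g [set: 'I_n].
  by rewrite -/(im g) imk cardsT card_ord leqNgt nk.
have kn : n = k by apply/eqP; rewrite eqn_leq le_nk.
subst n => {le_nk nk}.
rewrite (reindex_onto (fun s : 'S_k => pval s) (insubd (1%g : 'S_k))) /=.
  apply: eq_big => [s|s _]; last by apply: eq_bigr => i _; rewrite pvalE.
  rewrite (_ : insubd _ _ == s); last by apply/eqP; exact: valKd.
  rewrite andbT.
  have -> : im (pval s) == setT.
    apply/eqP/setP => t; rewrite inE; apply/imsetP.
    by exists ((s^-1)%g t) => //; rewrite pvalE permKV.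
  rewrite andbT; apply/forallP/eqP => [E|E i].
    rewrite -[RHS]map_tnth_enum; apply: eq_map => i.
    by have := E i; rewrite pvalE => /eqP.
  rewrite pvalE; apply/eqP.
  have -> : tnth l i = nth (tnth l i) l i by apply: tnth_nth.
  by rewrite -E (nth_map i) ?size_enum_ord // nth_ord_enum.
move=> g /andP[_ /eqP img]; apply: insubdK.
apply/injectiveP => i j; apply: (@imset_injP _ _ g setT _); rewrite ?inE //.
by rewrite -/(im g) img.
Qed.

End Polarization.

Lemma uinj_nceval (R : rngType) m (r : 'I_m -> R) (f : ncpoly m) :
  f@_mone = 0 ->
  uinj (nceval r f) = \sum_(u <- msupp f) (\prod_(i <- u) uinj (r i)) *~ f@_u.
Proof.
move=> f0; rewrite raddf_sum big_seq [RHS]big_seq; apply: eq_bigr => u uf.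
rewrite raddfMz /= uinj_rprod ?big_map //.
apply: contraTneq uf => u0; rewrite -mcoeff_eq0 -f0; apply/eqP.
congr (f@_ _); apply: val_inj.
by case: u u0 => -[]; rewrite //= fm1.
Qed.

(** Polarizing all monomials of f at once along a monomial w of top degree k with
    coefficient 1. Monomials of smaller degree disappear, those of degree k give
    permutations, and w itself gives the identity permutation. Evaluations of f
    take place in R, so they vanish even though the products are computed in the
    unitization. *)
Lemma PI_multilinear (R : rngType) : PI_rng R ->
  exists k (c : 'S_k -> int), c 1%g = 1 /\ forall y : 'I_k -> R,
    \sum_(s : 'S_k) (\prod_i uinj (y (s i))) *~ c s = 0.
Proof.
case=> m [f [f0 [w fw le_w] fr]].
have [k ek] : exists k, size w = k by exists (size w).
have wk : size w == k by apply/eqP.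
pose wt := tnth (Tuple wk).
(* [ws s] is the monomial w with its letters permuted by s. *)
pose ws (s : 'S_k) := FMonom [seq wt (s i) | i <- enum 'I_k].
exists k, (fun s => f@_(ws s)); split=> [|y].
  rewrite -fw; congr (f@_ _); apply: val_inj => /=.
  by under eq_map do rewrite perm1; rewrite map_tnth_enum.
pose r (T : {set 'I_k}) i := \sum_(t : 'I_k | (t \in T) && (wt t == i)) y t.
have : \sum_(T : {set 'I_k}) uinj (nceval (r T) f) *~ set_sign T = 0.
  by apply: big1 => T _; rewrite fr raddf0 mul0rz.
move=> E; rewrite -[RHS]E; apply/esym.
under eq_bigr => T _.
  rewrite uinj_nceval // mulrz_suml.
  under eq_bigr do rewrite -mulrzA mulrC mulrzA.
  over.
rewrite exchange_big /=.
transitivity (\sum_(u <- msupp f) \sum_(s : 'S_k | ws s == u)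
    (\prod_i uinj (y (s i))) *~ f@_u).
  rewrite big_seq [RHS]big_seq; apply: eq_bigr => u uf.
  rewrite -mulrz_suml -mulrz_suml; congr (_ *~ _).
  rewrite -(@polarize_monomial k _ _ wt (@uinj R \o y) _ (in_tuple u)) /=.
    apply: eq_bigr => T _; congr (_ *~ _); apply: eq_bigr => i _.
    by rewrite raddf_sum.
  by rewrite -ek -!fdegE le_w.
(* The sum over u has a single term, [ws s], or none if its coefficient is 0. *)
under eq_bigr do rewrite big_mkcond.
rewrite exchange_big; apply: eq_bigr => s _.
have [sf|sf] := boolP (ws s \in msupp f).
  rewrite (bigD1_seq (ws s)) /=; [|exact: sf|exact: fset_uniq].
  rewrite eqxx [X in _ + X]big1 ?addr0 // => u.
  by rewrite eq_sym => /negPf ->.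
rewrite (mcoeff_outdom sf) mulr0z big1_seq // => u /= uf.
by case: eqP => // us; rewrite us uf in sf.
Qed.

(** * Permutations of ordinals *)

(** Permuting the pieces of a word changes neither its length nor its weight. *)
Lemma big_flatten_perm (V : nmodType) (T : Type) k (F : 'I_k -> seq T)
    (s : 'S_k) (g : T -> V) :
  \sum_(t <- flatten [seq F (s i) | i <- enum 'I_k]) g t =
  \sum_(t <- flatten [seq F i | i <- enum 'I_k]) g t.
Proof.
rewrite !big_flatten 2!big_map !big_enum /=.
by rewrite [RHS](reindex_inj (@perm_inj _ s)).
Qed.

(** The least i moved by s: s permutes the j < i among themselves, so s i > i.
    This is why rearranging a decreasing sequence makes it lexicographically
    smaller. *)
Lemma perm_first_moved k (s : 'S_k) : s != 1%g ->
  exists i : 'I_k, (i < s i)%N /\ forall j : 'I_k, (j < i)%N -> s j = j.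
Proof.
move=> s1; have [i0 si0] : exists i, s i != i.
  apply/existsP; apply: contraNT s1; rewrite negb_exists => /forallP s1.
  by apply/eqP/permP => i; rewrite perm1; apply/eqP; rewrite -[_ == _]negbK.
case: (@arg_minnP _ i0 (fun i : 'I_k => s i != i) (@nat_of_ord k)) => //.
move=> i si min_i.
have fixlt (j : 'I_k) : (j < i)%N -> s j = j.
  by move=> ji; apply/eqP; apply: contraLR ji => /min_i; rewrite -leqNgt.
exists i; split=> //; rewrite ltnNge leq_eqVlt negb_or si /=.
apply: contra si => /fixlt /perm_inj si.
by rewrite si.
Qed.

Lemma enum_ord_split k (i : 'I_k) :
  enum 'I_k = take i (enum 'I_k) ++ i :: drop i.+1 (enum 'I_k).
Proof.
rewrite -[LHS](cat_take_drop i) (drop_nth i) ?size_enum_ord //.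
by rewrite nth_ord_enum.
Qed.

Lemma mem_take_enum_ord k (i j : 'I_k) :
  j \in take i (enum 'I_k) -> (j < i)%N.
Proof.
rewrite -(mem_map val_inj) map_take val_enum_ord take_iota mem_iota add0n.
by case/andP => _ /leq_trans; apply; rewrite geq_minl.
Qed.

(** * Words with weighted letters *)

Section Words.
Variables (R : rngType) (T : eqType) (v : T -> R) (wt : T -> nat).
Implicit Types (s u : seq T) (p : seq (T * seq T)).

Definition wval s : unitization R := \prod_(t <- s) uinj (v t).
Definition weight s : nat := (\sum_(t <- s) wt t)%N.
Definition light D s := all (fun t => (wt t <= D)%N) s.

Lemma wval_cat s u : wval (s ++ u) = wval s * wval u.
Proof. exact: big_cat. Qed.

Lemma weight_cat s u : weight (s ++ u) = (weight s + weight u)%N.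
Proof. exact: big_cat. Qed.

Lemma weight_ge t s : t \in s -> (wt t <= weight s)%N.
Proof.
by move=> /path.splitPr[s1 s2]; rewrite weight_cat /weight big_cons; lia.
Qed.

(** Pigeonhole: among q disjoint blocks, each one that is not light weighs at
    least D + 1. *)
Lemma light_block q m D s : (q * m <= size s)%N -> (weight s < q * D.+1)%N ->
  exists s1 u s2, [/\ s = s1 ++ u ++ s2, size u = m & light D u].
Proof.
elim: q s => [|q IH] s; first by rewrite mul0n.
rewrite !mulSn => le_s lt_s.
have su : size (take m s) = m by rewrite size_takel //; lia.
have [lu|/allPn[t tu Dt]] := boolP (light D (take m s)).
  by exists [::], (take m s), (drop m s); rewrite /= cat_take_drop.
have := weight_cat (take m s) (drop m s); rewrite cat_take_drop => ws.
have wu := weight_ge tu.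
case: (IH (drop m s)) => [||s1 [u [s2 [es um lu]]]];
  rewrite ?size_drop; try lia.
by exists (take m s ++ s1), u, s2; rewrite -catA -es cat_take_drop.
Qed.

Hypothesis light_nil : forall D, exists m, forall s,
  size s = m -> light D s -> wval s = 0.

(** A piece of a word is a pair: its first letter and the remaining ones. *)
Definition glue p := flatten [seq x.1 :: x.2 | x <- p].

(** Induction on k: the right half of the word has average weight at most 2 d and
    contains the k lighter letters, all of weight at most some D. The left half
    then supplies one letter heavier than D. The bound on the weights in the
    conclusion is what makes the next step possible. *)
Lemma descending_letters k d : exists D N, forall s,
  (N <= size s)%N -> (weight s <= d * size s)%N -> wval s != 0 ->
  exists s0 p, [/\ s = s0 ++ glue p, size p = k,
    sorted gtn [seq wt x.1 | x <- p] & all (fun x => wt x.1 <= D)%N p].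
Proof.
elim: k d => [|k IH] d.
  by exists 0, 0 => s _ _ _; exists s, [::]; rewrite cats0.
have [D [N HD]] := IH (2 * d)%N; have [m0 Hm0] := light_nil D.
(* The pigeonhole below divides by the block length, which must be positive. *)
have [m m_gt0 Hm] : exists2 m, (0 < m)%N & forall s, size s = m ->
    light D s -> wval s = 0.
  exists m0.+1 => // s sm ls; rewrite -(cat_take_drop m0 s) wval_cat.
  rewrite Hm0 ?mul0r // ?size_takel ?sm //.
  move: ls; rewrite -[in light D s](cat_take_drop m0 s) /light all_cat.
  by case/andP.
(* A left half of length h has about h / m blocks of length m. If none of them
   had all weights at most 8 d m, the total weight would be about 8 d h, which
   exceeds d (2 h + 1), an upper bound for it, as soon as h >= 2 m. *)
exists (8 * d * m)%N, (4 * m + 2 * N + 2)%N => s le_s ws sn0.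
set h := (size s)./2.
have hs : (size s <= h.*2.+1)%N by rewrite /h; lia.
have hs' : (h.*2 <= size s)%N by rewrite /h; lia.
have s1h : size (take h s) = h by rewrite size_takel //; lia.
have s2h : size (drop h s) = (size s - h)%N by rewrite size_drop.
have := weight_cat (take h s) (drop h s); rewrite cat_take_drop => wtd.
move: (sn0); rewrite -{1}(cat_take_drop h s) wval_cat => vn0.
have v1 : wval (take h s) != 0 by apply: contraNneq vn0 => ->; rewrite mul0r.
have v2 : wval (drop h s) != 0 by apply: contraNneq vn0 => ->; rewrite mulr0.
have [||s0 [p [e2 pk psort pD]]] := HD (drop h s) _ _ v2.
- by rewrite s2h; lia.
- rewrite s2h; nia.
have qm : (h < (h %/ m).+1 * m)%N by rewrite -ltn_divLR.
have qm' : (h %/ m * m <= h)%N by rewrite leq_divM.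
set q := (h %/ m)%N in qm qm'.
have [||s1 [u [s2 [e1 um ul]]]] := @light_block q m (8 * d * m) (take h s).
- by rewrite s1h.
- have : (8 * d * (h - m) <= 8 * d * (q * m))%N by rewrite leq_mul2l; lia.
  nia.
have [lu|/allPn[t tu Dt]] := boolP (light D u).
  by move: v1; rewrite e1 !wval_cat (Hm u) // mul0r mulr0 eqxx.
move: e1 ul; case/path.splitPr: tu => a b e1 ul.
exists (s1 ++ a), ((t, b ++ s2 ++ s0) :: p); split.
- by rewrite -(cat_take_drop h s) e1 e2 /glue /= -catA /= -?catA.
- by rewrite /= pk.
- rewrite /=; move: psort pD; case: (p) => //= x p' -> /andP[xD _].
  by rewrite andbT /gtn /=; lia.
- rewrite /=; apply/andP; split.
    by move: ul; rewrite /light all_cat /= => /and3P[].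
  apply: sub_all pD => x xD; apply: leq_trans xD _.
  move: ul; rewrite /light all_cat /= => /and3P[_ tD _]; lia.
Qed.

(** The weights read as digits in base B: the numerical order is the lexicographic
    order on sequences of the same length with digits below B. *)
Definition code B s := foldl (fun c t => (c * B + wt t)%N) 0 s.

Lemma foldl_code_bounds B c s : all (fun t => wt t < B)%N s ->
  (c * B ^ size s <= foldl (fun c t => (c * B + wt t)%N) c s
     < c.+1 * B ^ size s)%N.
Proof.
elim: s c => [|t s IH] c /=; first by rewrite expn0 !muln1 leqnn ltnSn.
case/andP=> tB sB; have /andP[lo hi] := IH (c * B + wt t)%N sB.
rewrite expnS; apply/andP; split; first by apply: leq_trans lo; nia.
by apply: leq_trans hi _; rewrite mulnA leq_mul2r; nia.
Qed.

Lemma code_lt B s x u y u' : size u = size u' -> (wt y < wt x)%N ->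
  light B (s ++ x :: u) -> light B (s ++ y :: u') ->
  (code B.+1 (s ++ y :: u') < code B.+1 (s ++ x :: u))%N.
Proof.
move=> su yx; rewrite /light !all_cat /= => /and3P[_ _ uB] /and3P[_ _ u'B].
rewrite /code !foldl_cat /=; set c := foldl _ _ s.
have /andP[_ hi] := @foldl_code_bounds B.+1 (c * B.+1 + wt y) u' u'B.
have /andP[lo _] := @foldl_code_bounds B.+1 (c * B.+1 + wt x) u uB.
apply: leq_trans hi _; apply: leq_trans lo; rewrite su leq_mul2r; lia.
Qed.

Lemma weight_light s : light (weight s) s.
Proof. by apply/allP => t /weight_ge. Qed.

Lemma wval_rprod s : s != [::] -> uinj (rprod (map v s)) = wval s.
Proof. by case: s => // t s _; rewrite uinj_rprod // big_map. Qed.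

(** A nonzero word s of minimal code among those of its length and weight is cut
    at its descending letters into s0 and k pieces. All other terms of the
    multilinear identity in these pieces are words of smaller code, so they are
    zero, and so is s. *)
Theorem sparse_words_vanish : PI_rng R ->
  forall d, exists N, forall s,
    (N <= size s)%N -> (weight s <= d * size s)%N -> wval s = 0.
Proof.
move=> /PI_multilinear[k [c [c1 multi]]] d.
have [D [N HN]] := descending_letters k d; exists N => s le_s ws.
have [n] := ubnP (code (d * size s).+1 s).
elim: n => // n IH in s le_s ws *; rewrite ltnS => code_s.
have [//|sn0] := eqVneq (wval s) 0.
have [s0 [p [es pk psort _]]] := HN s le_s ws sn0.
have pkb : size p == k by apply/eqP.
pose x := tnth (Tuple pkb); pose piece i := (x i).1 :: (x i).2.
pose word (g : 'S_k) := s0 ++ flatten [seq piece (g i) | i <- enum 'I_k].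
have wvalE g : wval (word g) = wval s0 * \prod_i wval (piece (g i)).
  rewrite wval_cat; congr (_ * _).
  by rewrite /wval big_flatten big_map enumT [index_enum _]unlock.
have eid : s = s0 ++ flatten [seq piece i | i <- enum 'I_k].
  rewrite es; congr (_ ++ flatten _); rewrite -[p]/(tval (Tuple pkb)).
  by rewrite -[in LHS](map_tnth_enum (Tuple pkb)) -map_comp.
have word1 : word 1%g = s.
  by rewrite eid /word; under eq_map do rewrite perm1.
have szw g : size (word g) = size s.
  rewrite eid !size_cat; congr addn; rewrite -!sum1_size.
  exact: (big_flatten_perm piece g (fun=> 1%N)).
have wtw g : weight (word g) = weight s.
  by rewrite eid !weight_cat; congr addn; apply: (big_flatten_perm piece g wt).
have lightw g : light (d * size s) (word g).
  by apply: sub_all (weight_light (word g)) => t /leq_trans; apply; rewrite wtw.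
have word0 g : g != 1%g -> wval (word g) = 0.
  move=> /perm_first_moved[i [ig gi]].
  apply: IH; rewrite ?szw ?wtw //; apply: leq_trans code_s.
  have split_word (h : 'S_k) : word h =
      (s0 ++ flatten [seq piece (h i) | i <- take i (enum 'I_k)]) ++
      (x (h i)).1 :: ((x (h i)).2 ++
        flatten [seq piece (h i) | i <- drop i.+1 (enum 'I_k)]).
    by rewrite /word [in LHS](enum_ord_split i) map_cat flatten_cat -catA.
  have e0 : [seq piece (g i) | i <- take i (enum 'I_k)] =
            [seq piece ((1%g : 'S_k) i) | i <- take i (enum 'I_k)].
    by apply/eq_in_map => j /mem_take_enum_ord /gi ->; rewrite perm1.
  have sg := szw g; have lg := lightw g.
  have s1 := szw 1%g; have l1 := lightw 1%g.
  rewrite -[X in (_ < code _ X)%N]word1.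
  rewrite !split_word e0 in sg lg s1 l1 *.
  apply: code_lt => //.
    by move: sg; rewrite -s1 !size_cat /= !size_cat; lia.
  rewrite perm1; have /= := sorted_ltn_nth (rev_trans ltn_trans) 0%N psort.
  have lt_sz (j : 'I_k) : (j < size [seq wt x.1 | x <- p])%N.
    by rewrite size_map pk.
  have xE (j : 'I_k) : nth 0%N [seq wt x.1 | x <- p] j = wt (x j).1.
    rewrite (nth_map (x j)) ?pk //; congr (wt _.1).
    by rewrite [RHS](tnth_nth (x j)).
  by move/(_ i (g i) (lt_sz _) (lt_sz _) ig); rewrite !xE.
have := congr1 ( *%R (wval s0)) (multi (fun i => rprod (map v (piece i)))).
rewrite mulr0 big_distrr /= (bigD1 1%g) //= c1 mulr1z.
rewrite [X in _ + X]big1 => [|g g1].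
  rewrite addr0 => <-; rewrite -word1 wvalE; congr (_ * _).
  apply: eq_bigr => i _; exact: esym (@wval_rprod (piece _) isT).
rewrite mulrzAr -[RHS](mul0rz _ (c g)) -(word0 g g1) wvalE.
congr (_ * _ *~ _); apply: eq_bigr => i _.
exact: (@wval_rprod (piece _) isT).
Qed.

End Words.

(** * Additive spans *)

Inductive zspan (V : zmodType) (P : V -> Prop) : V -> Prop :=
| zspan_gen x : P x -> zspan P x
| zspan0 : zspan P 0
| zspanB x y : zspan P x -> zspan P y -> zspan P (x - y).

Section Zspan.
Variables (V : zmodType) (P : V -> Prop).

Lemma zspanD x y : zspan P x -> zspan P y -> zspan P (x + y).
Proof.
move=> Px Py; rewrite -[y]opprK; apply: zspanB => //.
by rewrite -sub0r; apply: zspanB => //; apply: zspan0.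
Qed.

Lemma zspan_sum (I : eqType) (r : seq I) (F : I -> V) :
  (forall i, i \in r -> zspan P (F i)) -> zspan P (\sum_(i <- r) F i).
Proof.
move=> PF; rewrite big_seq; apply: big_ind => //; first exact: zspan0.
exact: zspanD.
Qed.

Lemma zspanMn x n : zspan P x -> zspan P (x *+ n).
Proof.
move=> Px; elim: n => [|n IH]; first exact: zspan0.
by rewrite mulrS; apply: zspanD.
Qed.

Lemma zspan_additive (W : zmodType) (Q : W -> Prop) (h : {additive V -> W}) x :
  (forall y, P y -> zspan Q (h y)) -> zspan P x -> zspan Q (h x).
Proof.
move=> PQ; elim=> [y|| y z _ IHy _ IHz]; first exact: PQ.
  by rewrite raddf0; apply: zspan0.
by rewrite raddfB; apply: zspanB.
Qed.

End Zspan.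

Lemma zspan_mul (R : rngType) (P Q S : R -> Prop) a b :
  (forall x y, P x -> Q y -> zspan S (x ** y)) ->
  zspan P a -> zspan Q b -> zspan S (a ** b).
Proof.
move=> PQS Pa Qb; apply: (zspan_additive (h := rmulr b)) Pa => x Px.
by apply: (zspan_additive (h := rmul x)) Qb => y; apply: PQS.
Qed.

Lemma rprod_cons (R : rngType) (a : R) s : s != [::] ->
  rprod (a :: s) = a ** rprod s.
Proof.
by move=> s0; apply: uinj_inj; rewrite uinjM !uinj_rprod // big_cons.
Qed.

Lemma rprod_cat (R : rngType) (s u : seq R) : s != [::] -> u != [::] ->
  rprod (s ++ u) = rprod s ** rprod u.
Proof.
move=> s0 u0; apply: uinj_inj; rewrite uinjM !uinj_rprod ?big_cat //.
by case: s s0.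
Qed.

(** * The filtration of the differential polynomial ring *)

Section Filtration.
Variables (R : rngType) (delta : derivation R) (A : seq R).

(** The letter (a, j) stands for delta^j(a). Keeping j as data gives it a weight
    that does not depend on coincidences between the values. *)
Definition letter : eqType := (seq_sub A * nat)%type.
Definition lval (t : letter) : R := iter t.2 delta (ssval t.1).
Definition lweight (t : letter) := t.2.

(** Empty words are excluded because [rprod] has no meaningful value on them. *)
Definition is_word n w (a : R) := exists s : seq letter,
  [/\ s != [::], size s = n, weight lweight s = w & a = rprod (map lval s)].

Definition wspan n w := zspan (is_word n w).

Lemma wspan_letter t : wspan 1 (lweight t) (lval t).
Proof. by apply: zspan_gen; exists [:: t]; rewrite /weight big_seq1. Qed.

Lemma wspanM n w a n' w' b : wspan n w a -> wspan n' w' b ->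
  wspan (n + n') (w + w') (a ** b).
Proof.
apply: zspan_mul => x y [s [s0 sn sw ->]] [u [u0 un uw ->]]; apply: zspan_gen.
exists (s ++ u); rewrite size_cat weight_cat sn un sw uw map_cat.
rewrite rprod_cat; first by split=> //; case: (s) s0.
- by case: (s) s0.
- by case: (u) u0.
Qed.

(** By the Leibniz rule delta of a word is the sum of the words in which one
    letter delta^j(a) has become delta^(j+1)(a). *)
Lemma wspan_delta_word s : s != [::] ->
  wspan (size s) (weight lweight s).+1 (delta (rprod (map lval s))).
Proof.
elim: s => // t s IH _.
have tD : wspan 1 (lweight t).+1 (delta (lval t)).
  exact: (wspan_letter (t.1, t.2.+1)).
have [->|s0] := eqVneq s [::]; first by rewrite /weight big_seq1.
rewrite map_cons rprod_cons; last by case: (s) s0.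
rewrite derivationM /weight big_cons -/(weight lweight s).
rewrite -[size _]/(1 + size s)%N.
apply: zspanD.
  rewrite -addSn; apply: wspanM => //.
  by apply: zspan_gen; exists s.
by rewrite -addnS; apply: wspanM (wspan_letter t) (IH s0).
Qed.

Lemma wspan_delta n w a : wspan n w a -> wspan n w.+1 (delta a).
Proof.
by apply: zspan_additive => _ [s [s0 <- <- ->]]; apply: wspan_delta_word.
Qed.

Lemma wspan_iter_delta n w a j :
  wspan n w a -> wspan n (w + j) (iter j delta a).
Proof.
move=> wa; elim: j => [|j IH]; first by rewrite addn0.
by rewrite addnS iterS; apply: wspan_delta.
Qed.

Variable d : nat.

(** The parameter m is only a lower bound for the length n of the words, which
    makes the filtration decreasing, while the weight plus the degree in x is
    compared with the actual length. *)
Definition is_mono m (f : diffpoly delta) := exists n w q a,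
  [/\ (m <= n)%N, (w + q <= d * n)%N, wspan n w a & f = << a *g q >>].

Definition filtered m := zspan (is_mono m).

(** In (a x^p)(b x^q) the term a delta^j(b) x^(p+q-j) has gained weight j and lost
    j powers of x, so weight plus degree is additive. *)
Lemma filteredM m f m' g : filtered m f -> filtered m' g ->
  filtered (m + m') (f ** g).
Proof.
apply: zspan_mul => _ _ [n [w [p [a [mn wp wa ->]]]]]
  [n' [w' [q [b [mn' wq wb ->]]]]].
rewrite diffpoly_mulUU; apply: zspan_sum => j _; apply: zspan_gen.
have jp := ltn_ord j.
exists (n + n')%N, (w + (w' + j))%N, (p + q - j)%N.
exists ((a ** iter j delta b) *+ 'C(p, j)).
split=> //; first by lia.
  by rewrite mulnDr; lia.
by apply: zspanMn; apply: wspanM => //; apply: wspan_iter_delta.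
Qed.

Lemma filtered_le m m' f : (m' <= m)%N -> filtered m f -> filtered m' f.
Proof.
move=> le_m; apply: (zspan_additive (h := idfun)).
move=> g [n [w [q [a [mn wq wa ->]]]]].
by apply: zspan_gen; exists n, w, q, a; split=> //; apply: leq_trans mn.
Qed.

Lemma filtered_rprod (s : seq (diffpoly delta)) :
  s != [::] -> (forall f, f \in s -> filtered 1 f) ->
  filtered (size s) (rprod s).
Proof.
elim: s => // f s IH _ sf.
have f1 : filtered 1 f by apply: sf; rewrite mem_head.
have [->//|s0] := eqVneq s [::].
rewrite rprod_cons // -[size _]/(1 + size s)%N; apply: filteredM => //.
by apply: IH => // g gs; apply: sf; rewrite inE gs orbT.
Qed.

Lemma filtered_vanish N f : (forall s : seq letter,
    (N <= size s)%N -> (weight lweight s <= d * size s)%N -> wval lval s = 0) ->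
  filtered N f -> f = 0.
Proof.
move=> wN; elim=> [_ [n [w [q [a [Nn wq wa ->]]]]]|//|x y _ -> _ ->];
  last exact: subr0.
suff -> : a = 0 by rewrite monalgU0.
elim: wa => [_ [s [s0 sn sw ->]]|//|x y _ -> _ ->];
  last exact: subr0.
apply: uinj_inj; rewrite wval_rprod // raddf0 wN ?sn ?sw //; lia.
Qed.

End Filtration.

Theorem theorem1p1 (R : rngType) (delta : derivation R) :
  locally_nilpotent R -> PI_rng R -> locally_nilpotent (diffpoly delta).
Proof.
move=> lnR piR X.
pose A := flatten [seq [seq f@_q | q <- msupp f] | f <- X].
pose d := (\max_(f <- X) \max_(q <- msupp f) q)%N.
have lnil D : exists m, forall s : seq (letter A),
    size s = m -> light (@lweight R A) D s -> wval (@lval R delta A) s = 0.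
  (* Light letters take finitely many values, so they generate a nilpotent
     subring. *)
  have [m m0 Hm] := lnR [seq iter j delta a | a <- A, j <- iota 0 D.+1].
  exists m => s sm ls; have sm' : size (map (@lval R delta A) s) == m.
    by rewrite size_map sm.
  have s0 : s != [::] by rewrite -size_eq0 sm -lt0n.
  rewrite -wval_rprod // -(raddf0 (@uinj R)); congr uinj.
  apply: (Hm (Tuple sm')) => _ /mapP[t /(allP ls) tD ->] S _; apply.
  apply/allpairsPdep; exists (ssval t.1), t.2; split=> //; first exact: ssvalP.
  by rewrite mem_iota.
have [N HN] := sparse_words_vanish lnil piR d.
have X1 f : subrng_gen X f -> filtered A d 1 f.
  apply; first split; first exact: zspan0.
  - by move=> x y; apply: zspanB.
  - by move=> x y x1 y1; apply: filtered_le (filteredM x1 y1).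
  move=> g gX; rewrite [g]monalgE; apply: zspan_sum => q qg.
  have gA : g@_q \in A.
    by apply/flattenP; exists [seq g@_q | q <- msupp g]; apply: map_f.
  apply: zspan_gen; exists 1%N, 0%N, q, g@_q; split=> //.
    rewrite add0n muln1 /d.
    apply: (bigmaxn_sup_seq g) => //; exact: (leq_bigmax_seq q).
  exact: (wspan_letter delta (SeqSub gA, 0%N)).
exists N.+1 => // s sX.
apply: (@filtered_vanish _ _ A d N) => //.
apply: (@filtered_le _ _ _ _ (size s)); first by rewrite size_tuple.
apply: filtered_rprod => [|f /sX]; last exact: X1.
by rewrite -size_eq0 size_tuple.
Qed.
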